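(* If $G$ is a belt, then $\chi(G)\le\lceil\frac54\omega(G)\rceil$.
   Context: A belt is a $(P_6,C_4,C_6)$-free graph whose vertex set is partitioned into seven sets $Q_1,\dots,Q_5,R_2,R_3$ such that: $Q_1,\dots,Q_5$ are non-empty cliques; $Q_1$ is complete to $Q_2\cup R_2\cup Q_5$ and $Q_4$ is complete to $Q_3\cup R_3\cup Q_5$; $Q_1$ is anticomplete to $Q_3\cup R_3\cup Q_4$, $Q_4$ is anticomplete to $Q_2\cup R_2\cup Q_1$, $Q_5$ is anticomplete to $Q_2\cup R_2\cup Q_3\cup R_3$; for each $j\in\{2,3\}$, $Q_j$ is complete to $R_j$, every vertex of $Q_j\cup R_j$ has a neighbor in $Q_{5-j}\cup R_{5-j}$, and no vertex of $R_j$ is adjacent to all other vertices of $R_j$. Complete/anticomplete: all edges / no edges between the sets. *)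

(* Defs.v *)
(* Simple graphs are symmetric irreflexive relations on a finType. *)
From mathcomp Require Import all_boot.
Set Implicit Arguments. Unset Strict Implicit. Unset Printing Implicit Defensive.

Section Graphs.
Variables (T : finType) (e : rel T).

Definition induced_free (k : nat) (h : rel 'I_k) : Prop :=
  ~ exists f : 'I_k -> T, injective f /\ forall i j, e (f i) (f j) = h i j.

Definition clique (A : {set T}) : Prop :=
  forall x y, x \in A -> y \in A -> x != y -> e x y.

Definition cliqueb (A : {set T}) : bool :=
  [forall x, forall y, [&& x \in A, y \in A & x != y] ==> e x y].

Definition omega : nat := \max_(K : {set T} | cliqueb K) #|K|.

Definition colorable (k : nat) : bool :=
  [exists f : {ffun T -> 'I_k}, [forall x, forall y, e x y ==> (f x != f y)]].

(* chromatic number: least k <= #|T| with a proper k-colouring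
   (a proper #|T|-colouring always exists for irreflexive e) *)
Definition chi : nat := \big[minn/#|T|]_(k < #|T|.+1 | colorable k) k.

Definition complete (A B : {set T}) : Prop :=
  forall x y, x \in A -> y \in B -> e x y.
Definition anticomplete (A B : {set T}) : Prop :=
  forall x y, x \in A -> y \in B -> ~~ e x y.

Definition belt : Prop :=
  induced_free (fun i j : 'I_6 => (i.+1 == j :> nat) || (j.+1 == i :> nat)) /\
  induced_free (fun i j : 'I_4 => (i.+1 %% 4 == j :> nat) || (j.+1 %% 4 == i :> nat)) /\
  induced_free (fun i j : 'I_6 => (i.+1 %% 6 == j :> nat) || (j.+1 %% 6 == i :> nat)) /\
  exists Q1 Q2 Q3 Q4 Q5 R2 R3 : {set T},
    (forall x, count (fun A : {set T} => x \in A) [:: Q1; Q2; Q3; Q4; Q5; R2; R3] = 1) /\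
    [/\ Q1 != set0, Q2 != set0, Q3 != set0, Q4 != set0 & Q5 != set0] /\
    [/\ clique Q1, clique Q2, clique Q3, clique Q4 & clique Q5] /\
    complete Q1 (Q2 :|: R2 :|: Q5) /\ complete Q4 (Q3 :|: R3 :|: Q5) /\
    anticomplete Q1 (Q3 :|: R3 :|: Q4) /\ anticomplete Q4 (Q2 :|: R2 :|: Q1) /\
    anticomplete Q5 (Q2 :|: R2 :|: Q3 :|: R3) /\
    complete Q2 R2 /\ complete Q3 R3 /\
    (forall x, x \in Q2 :|: R2 -> exists2 y, y \in Q3 :|: R3 & e x y) /\
    (forall x, x \in Q3 :|: R3 -> exists2 y, y \in Q2 :|: R2 & e x y) /\
    (forall x, x \in R2 -> exists2 y, y \in R2 & (y != x) && ~~ e x y) /\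
    (forall x, x \in R3 -> exists2 y, y \in R3 & (y != x) && ~~ e x y).

End Graphs.

(* Main.v *)
(* Put A = Q2 u R2, B = Q3 u R3, w = omega and let w + h be the number of colours,
   so that w <= 4h.  Excluding C4, C6 and P6 gives: non-adjacent vertices of A have
   disjoint neighbourhoods in B, adjacent ones have nested neighbourhoods inside A,
   and the ends of an induced P3 in A see no more of B than its middle vertex.
   Colour the subsets S of the vertex set by induction on #|S|, so that all degrees
   in S may be assumed to be at least w + h.  If neither A nor B is a clique in S,
   each contains two non-adjacent simplicial vertices; by the degree bound each of
   these four has more than h neighbours on the other side, and these
   neighbourhoods form a clique of size larger than 4h.
   So let B be a clique.  Then A can be coloured greedily, larger neighbourhoods
   first, with the colours not used on Q1, as soon as Q1 shares the colours of a
   set Y in B with #|N_B(v) n Y| >= min(#|Q1|, #|N_B(v)|) - h for all v in A.  The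
   sets N_B(v) are laminar, so a minimal such Y is determined by at most three
   disjoint neighbourhoods of size larger than h, which bounds #|Y|. *)
Require Import Defs.
From mathcomp Require Import all_boot zify.
Set Implicit Arguments. Unset Strict Implicit. Unset Printing Implicit Defensive.

(** * Forbidden induced subgraphs and the pentagon of sets *)

Section InducedSubgraphs.
Variables (T : finType) (e : rel T).
Hypotheses (e_sym : symmetric e) (e_irr : irreflexive e).

(* Distinct vertices of P6 and of C6 have distinct neighbourhoods, so a map
   respecting adjacency is automatically injective. *)
Lemma twin_free_absurd (k : nat) (g : rel 'I_k) (f : 'I_k -> T) :
  induced_free e g -> (forall i j, (forall l, g i l = g j l) -> i = j) ->
  (forall i j, e (f i) (f j) = g i j) -> False.
Proof.
move=> free twin_free adj; apply: free; exists f; split=> // i j eq_f.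
by apply: twin_free => l; rewrite -!adj eq_f.
Qed.

Lemma P6_free_absurd :
  induced_free e (fun i j : 'I_6 => (i.+1 == j :> nat) || (j.+1 == i :> nat)) ->
  forall x0 x1 x2 x3 x4 x5,
  e x0 x1 -> e x1 x2 -> e x2 x3 -> e x3 x4 -> e x4 x5 ->
  ~~ e x0 x2 -> ~~ e x0 x3 -> ~~ e x0 x4 -> ~~ e x0 x5 ->
  ~~ e x1 x3 -> ~~ e x1 x4 -> ~~ e x1 x5 ->
  ~~ e x2 x4 -> ~~ e x2 x5 -> ~~ e x3 x5 -> False.
Proof.
move=> free x0 x1 x2 x3 x4 x5 h01 h12 h23 h34 h45.
move=> /negbTE h02 /negbTE h03 /negbTE h04 /negbTE h05 /negbTE h13 /negbTE h14.
move=> /negbTE h15 /negbTE h24 /negbTE h25 /negbTE h35.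
pose f (i : 'I_6) := nth x0 [:: x0; x1; x2; x3; x4; x5] i.
apply: (twin_free_absurd (f := f) free) => i j; rewrite /f.
  move=> same; apply: val_inj; have := same (inord 1); have := same (inord 3).
  have := same (inord 4); have := same (inord 2).
  by rewrite !inordK //=; case: i {same} => [] [|[|[|[|[|[|//]]]]]] hi;
    case: j => [] [|[|[|[|[|[|//]]]]]] hj.
case: i => [] [|[|[|[|[|[|//]]]]]] hi;
    case: j => [] [|[|[|[|[|[|//]]]]]] hj //=;
    rewrite ?e_irr //; first [by assumption | by rewrite e_sym].
Qed.

Lemma C6_free_absurd :
  induced_free e
    (fun i j : 'I_6 => (i.+1 %% 6 == j :> nat) || (j.+1 %% 6 == i :> nat)) ->
  forall x0 x1 x2 x3 x4 x5,
  e x0 x1 -> e x1 x2 -> e x2 x3 -> e x3 x4 -> e x4 x5 -> e x5 x0 ->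
  ~~ e x0 x2 -> ~~ e x0 x3 -> ~~ e x0 x4 ->
  ~~ e x1 x3 -> ~~ e x1 x4 -> ~~ e x1 x5 ->
  ~~ e x2 x4 -> ~~ e x2 x5 -> ~~ e x3 x5 -> False.
Proof.
move=> free x0 x1 x2 x3 x4 x5 h01 h12 h23 h34 h45 h50.
move=> /negbTE h02 /negbTE h03 /negbTE h04 /negbTE h13 /negbTE h14.
move=> /negbTE h15 /negbTE h24 /negbTE h25 /negbTE h35.
pose f (i : 'I_6) := nth x0 [:: x0; x1; x2; x3; x4; x5] i.
apply: (twin_free_absurd (f := f) free) => i j; rewrite /f.
  move=> same; apply: val_inj; have := same (inord 1); have := same (inord 3).
  have := same (inord 4); have := same (inord 2).
  by rewrite !inordK //=; case: i {same} => [] [|[|[|[|[|[|//]]]]]] hi;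
    case: j => [] [|[|[|[|[|[|//]]]]]] hj.
case: i => [] [|[|[|[|[|[|//]]]]]] hi;
    case: j => [] [|[|[|[|[|[|//]]]]]] hj //=;
    rewrite ?e_irr //; first [by assumption | by rewrite e_sym].
Qed.

(** Opposite vertices of C4 are twins, so [twin_free_absurd] does not apply and their distinctness
    has to be assumed. *)
Lemma C4_free_absurd :
  induced_free e
    (fun i j : 'I_4 => (i.+1 %% 4 == j :> nat) || (j.+1 %% 4 == i :> nat)) ->
  forall x0 x1 x2 x3, e x0 x1 -> e x1 x2 -> e x2 x3 -> e x3 x0 ->
  x0 != x2 -> ~~ e x0 x2 -> x1 != x3 -> ~~ e x1 x3 -> False.
Proof.
move=> free x0 x1 x2 x3 h01 h12 h23 h30 n02 /negbTE h02 n13 /negbTE h13.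
pose f (i : 'I_4) := nth x0 [:: x0; x1; x2; x3] i.
have adj i j : e (f i) (f j) = (i.+1 %% 4 == j :> nat) || (j.+1 %% 4 == i :> nat).
  rewrite /f; case: i => [] [|[|[|[|//]]]] hi;
    case: j => [] [|[|[|[|//]]]] hj //=;
    rewrite ?e_irr //; first [by assumption | by rewrite e_sym].
apply: free; exists f; split => // i j eq_f; apply: val_inj.
have ne x y : e x y -> x != y by move=> exy; apply: contraTneq exy => ->; rewrite e_irr.
move: eq_f; rewrite /f; move/eqP; apply: contraTeq.
case: (i) => [] [|[|[|[|//]]]] hi; case: (j) => [] [|[|[|[|//]]]] hj //= _;
  first [by assumption | by rewrite eq_sym | by rewrite ne | by rewrite eq_sym ne].
Qed.

Lemma neq_of_edge x y : e x y -> x != y.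
Proof. by move=> exy; apply: contraTneq exy => ->; rewrite e_irr. Qed.

(** Distinctness is included because a vertex is not adjacent to itself, so anticomplete sets may
    overlap. *)
Definition apart (X Y : {set T}) : Prop :=
  forall x y, x \in X -> y \in Y -> (x != y) && ~~ e x y.

(** A blow-up of the 5-cycle Q1, A, B, Q4, Q5 with arbitrary edges inside A, inside B and between A
    and B. Unlike the belt itself, it passes to induced subgraphs. *)
Record ring5 (Q1 A B Q4 Q5 : {set T}) : Prop := Ring5 {
  ring5_cl1 : clique e Q1;
  ring5_cl4 : clique e Q4;
  ring5_cl5 : clique e Q5;
  ring5_1A : complete e Q1 A;
  ring5_4B : complete e Q4 B;
  ring5_15 : complete e Q1 Q5;
  ring5_45 : complete e Q4 Q5;
  ring5_1B : apart Q1 B;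
  ring5_4A : apart Q4 A;
  ring5_14 : apart Q1 Q4;
  ring5_5A : apart Q5 A;
  ring5_5B : apart Q5 B;
  ring5_AB : forall x, x \in A -> x \notin B }.

Lemma apart_sym X Y : apart X Y -> apart Y X.
Proof. by move=> h x y hx hy; rewrite eq_sym e_sym h. Qed.

Lemma ring5_sym Q1 A B Q4 Q5 : ring5 Q1 A B Q4 Q5 -> ring5 Q4 B A Q1 Q5.
Proof.
case=> *; constructor=> //; first exact: apart_sym.
by move=> x xB; apply/negP => xA; move: xB; apply/negP; auto.
Qed.

Lemma ring5_setI S Q1 A B Q4 Q5 : ring5 Q1 A B Q4 Q5 ->
  ring5 (Q1 :&: S) (A :&: S) (B :&: S) (Q4 :&: S) (Q5 :&: S).
Proof.
case=> c1 c4 c5 h1 h2 h3 h4 h5 h6 h7 h8 h9 hAB.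
constructor; try by move=> x y /setIP[? _] /setIP[? _]; auto.
by move=> x /setIP[xA _]; rewrite inE (negbTE (hAB _ xA)).
Qed.

(** These consequences of the forbidden subgraphs survive deletion of vertices. Their derivation
    does not: it needs Q1, Q4, Q5 non-empty and neighbours in B. *)
Record tame (A B : {set T}) : Prop := Tame {
  tame_disj : forall a a' b, a \in A -> a' \in A -> b \in B ->
    a != a' -> ~~ e a a' -> e a b -> ~~ e a' b;
  tame_C4 : forall a a' b b', a \in A -> a' \in A -> b \in B -> b' \in B ->
    e a a' -> e b b' -> e a b -> e a' b' -> e a b' || e a' b;
  tame_P3 : forall a a' a'' b, a \in A -> a' \in A -> a'' \in A -> b \in B ->
    e a a' -> e a' a'' -> a != a'' -> ~~ e a a'' -> e a b -> e a' b;
  tame_nest : forall a a' w w', a \in A -> a' \in A -> w \in A -> w' \in A ->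
    e a a' -> e a w -> e a' w' -> w != a' -> w' != a -> e a' w || e a w' }.

Lemma tame_setI S A B : tame A B -> tame (A :&: S) (B :&: S).
Proof.
case=> h1 h2 h3 h4; constructor.
- by move=> a a' b /setIP[? _] /setIP[? _] /setIP[? _]; apply: h1.
- by move=> a a' b b' /setIP[? _] /setIP[? _] /setIP[? _] /setIP[? _]; apply: h2.
- by move=> a a' a'' b /setIP[? _] /setIP[? _] /setIP[aA _] /setIP[? _] *; apply: (h3 a a' a'').
- by move=> a a' b b' /setIP[? _] /setIP[? _] /setIP[? _] /setIP[? _]; apply: h4.
Qed.

(** * Adjacency rules forced by excluding P6, C4 and C6 *)

Section Structure.
Hypothesis free_P6 :
  induced_free e (fun i j : 'I_6 => (i.+1 == j :> nat) || (j.+1 == i :> nat)).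
Hypothesis free_C4 : induced_free e
  (fun i j : 'I_4 => (i.+1 %% 4 == j :> nat) || (j.+1 %% 4 == i :> nat)).
Hypothesis free_C6 : induced_free e
  (fun i j : 'I_6 => (i.+1 %% 6 == j :> nat) || (j.+1 %% 6 == i :> nat)).
Variables (Q1 A B Q4 Q5 : {set T}).
Hypothesis ring : ring5 Q1 A B Q4 Q5.
Hypotheses (Q1_n0 : Q1 != set0) (Q4_n0 : Q4 != set0) (Q5_n0 : Q5 != set0).
Hypothesis A_nbr : forall x, x \in A -> exists2 y, y \in B & e x y.

(** A common neighbour b would close an induced C4 q, a, b, a' with q in Q1. *)
Lemma ring_disj a a' b : a \in A -> a' \in A -> b \in B ->
  a != a' -> ~~ e a a' -> e a b -> ~~ e a' b.
Proof.
move=> aA a'A bB ne nadj ab; apply/negP => a'b.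
have [q qQ] := set0Pn _ Q1_n0.
have /andP[nqb qb] := ring5_1B ring qQ bB.
apply: (C4_free_absurd free_C4 (ring5_1A ring qQ aA) ab _ _ nqb qb ne nadj).
  by rewrite e_sym.
by rewrite e_sym (ring5_1A ring).
Qed.

(** Otherwise q, a, b, r, b', a' is an induced C6 with q in Q1 and r in Q4. *)
Lemma ring_cross a a' b b' : a \in A -> a' \in A -> b \in B -> b' \in B ->
  a != a' -> ~~ e a a' -> e a b -> e a' b' -> e b b'.
Proof.
move=> aA a'A bB b'B ne nadj ab a'b'; apply: contraT => nbb.
have [q qQ] := set0Pn _ Q1_n0; have [r rQ] := set0Pn _ Q4_n0.
have /andP[_ qb] := ring5_1B ring qQ bB.
have /andP[_ qb'] := ring5_1B ring qQ b'B.
have /andP[_ ra] := ring5_4A ring rQ aA.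
have /andP[_ ra'] := ring5_4A ring rQ a'A.
have /andP[_ qr] := ring5_14 ring qQ rQ.
have a'b := ring_disj aA a'A bB ne nadj ab.
have ab' : ~~ e a b'.
  by apply: (ring_disj a'A aA b'B _ _ a'b'); rewrite 1?eq_sym // e_sym.
exfalso; apply: (C6_free_absurd free_C6 (ring5_1A ring qQ aA) ab
  (_ : e b r) (ring5_4B ring rQ b'B) (_ : e b' a') (_ : e a' q)) => //;
  rewrite e_sym //; [exact: (ring5_4B ring) | exact: (ring5_1A ring)].
Qed.

(** Otherwise r, q, b, a, a', a'' is an induced P6 with r in Q5 and q in Q4. *)
Lemma ring_P3 a a' a'' b : a \in A -> a' \in A -> a'' \in A -> b \in B ->
  e a a' -> e a' a'' -> a != a'' -> ~~ e a a'' -> e a b -> e a' b.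
Proof.
move=> aA a'A a''A bB aa' a'a'' ne nadj ab; apply: contraT => a'b.
have [q qQ] := set0Pn _ Q4_n0; have [r rQ] := set0Pn _ Q5_n0.
have /andP[_ rb] := ring5_5B ring rQ bB.
have /andP[_ ra] := ring5_5A ring rQ aA.
have /andP[_ ra'] := ring5_5A ring rQ a'A.
have /andP[_ ra''] := ring5_5A ring rQ a''A.
have /andP[_ qa] := ring5_4A ring qQ aA.
have /andP[_ qa'] := ring5_4A ring qQ a'A.
have /andP[_ qa''] := ring5_4A ring qQ a''A.
have a''b := ring_disj aA a''A bB ne nadj ab.
exfalso; apply: (P6_free_absurd free_P6 (_ : e r q) (ring5_4B ring qQ bB) (_ : e b a)
  aa' a'a'') => //; rewrite e_sym //; exact: (ring5_45 ring).
Qed.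

Lemma ring_tame : tame A B.
Proof.
constructor; [exact: ring_disj | | exact: ring_P3 |].
  move=> a a' b b' aA a'A bB b'B aa' bb' ab a'b'.
  apply: contraT; rewrite negb_or => /andP[ab' a'b]; exfalso.
  apply: (C4_free_absurd free_C4 ab bb' (_ : e b' a') (_ : e a' a)) => //;
    try by rewrite e_sym.
    by apply: contraTneq b'B => <-; rewrite (ring5_AB ring).
  by apply: contraTneq bB => ->; rewrite (ring5_AB ring).
move=> a a' w w' aA a'A wA w'A aa' aw a'w' wa' w'a.
apply: contraT; rewrite negb_or => /andP[a'w aw']; exfalso.
have a'a : e a' a by rewrite e_sym.
have wa : e w a by rewrite e_sym.
have w'a' : e w' a' by rewrite e_sym.
have nwa' : ~~ e w a' by rewrite e_sym.
have nw'a : ~~ e w' a by rewrite e_sym.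
have nww' : w != w' by apply: contraNneq a'w => ->.
have aw_ : a != w' by rewrite eq_sym.
(* If w and w' are adjacent, a, w, w', a' is an induced C4. If not, their neighbours b, b' in B are
   adjacent by [ring_cross], and [ring_P3] passes them on to a and a', so that a, b, b', a' is
   one. *)
have [ww'|ww'] := boolP (e w w').
  by apply: (C4_free_absurd free_C4 aw ww' w'a' a'a aw_ aw' wa' nwa').
have [b bB wb] := A_nbr wA; have [b' b'B w'b'] := A_nbr w'A.
have bb' := ring_cross wA w'A bB b'B nww' ww' wb w'b'.
have ab := ring_P3 wA aA a'A bB wa aa' wa' nwa' wb.
have a'b' := ring_P3 w'A a'A aA b'B w'a' a'a w'a nw'a w'b'.
have a'b := ring_disj wA a'A bB wa' nwa' wb.
have ab' := ring_disj w'A aA b'B w'a nw'a w'b'.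
have ne : a != b' by apply: contraTneq b'B => <-; rewrite (ring5_AB ring).
have ne' : b != a' by apply: contraTneq bB => ->; rewrite (ring5_AB ring).
apply: (C4_free_absurd free_C4 ab bb' (_ : e b' a') a'a ne ab' ne'); by rewrite e_sym.
Qed.

End Structure.
End InducedSubgraphs.

(** * Small hitting sets of laminar families *)

Lemma subset_of_card (T : finType) (Y B : {set T}) m :
  Y \subset B -> #|Y| <= m <= #|B| ->
  exists2 Z : {set T}, Y \subset Z & (Z \subset B) && (#|Z| == m).
Proof.
move=> YB /andP[Ym mB].
pose Z := Y :|: [set x in take (m - #|Y|) (enum (B :\: Y))].
exists Z; first exact: subsetUl.
have sub x : x \in take (m - #|Y|) (enum (B :\: Y)) -> x \in B :\: Y.
  by move/mem_take; rewrite mem_enum.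
apply/andP; split.
  rewrite subUset YB; apply/subsetP=> x; rewrite inE => /sub.
  by rewrite inE => /andP[].
rewrite cardsU (_ : Y :&: _ = set0) ?cards0 ?subn0.
  rewrite cardsE (card_uniqP _) ?take_uniq ?enum_uniq // size_take -cardE.
  rewrite cardsD (setIidPr YB); case: ltnP; lia.
apply/setP=> x; rewrite !inE; apply/negP=> /andP[xY /sub].
by rewrite inE xY.
Qed.

(* In a minimal Y every point lies in a member of F where the requirement is
   tight; the maximal tight members are disjoint and p is their number. *)
Lemma laminar_hitting (T : finType) (F : {set {set T}}) (B : {set T}) (q h : nat) :
  (forall X, X \in F -> X \subset B) ->
  (forall X Z, X \in F -> Z \in F ->
     [|| X \subset Z, Z \subset X | [disjoint X & Z]]) ->
  exists (Y : {set T}) (p : nat),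
    [/\ Y \subset B, forall X, X \in F -> minn q #|X| <= #|X :&: Y| + h,
        #|Y| + p * h <= p * q, #|Y| + p * h <= #|B| & p * h.+1 <= #|B|].
Proof.
move=> FB lam.
pose ok (Y : {set T}) :=
  (Y \subset B) && [forall X in F, minn q #|X| <= #|X :&: Y| + h].
have okB : ok B.
  rewrite /ok subxx; apply/forall_inP=> X XF.
  by rewrite (setIidPl (FB _ XF)); lia.
case: (arg_minnP (fun Y : {set T} => #|Y|) okB) => Y /andP[YB /forall_inP okY] minY.
(* The strict inequality leaves out members with at most h points; this gives [p * h.+1 <= #|B|]. *)
pose tight := [set X in F | (h < minn q #|X|) && (minn q #|X| == #|X :&: Y| + h)].
pose M := [set X in tight | [forall Z in tight, (X \subset Z) ==> (X == Z)]].
have Mtight X : X \in M -> X \in tight by rewrite inE => /andP[].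
have Mmax X Z : X \in M -> Z \in tight -> X \subset Z -> X = Z.
  by rewrite inE => /andP[_ /forall_inP m] /m /implyP mm /mm /eqP.
have trivM : trivIset M.
  apply/trivIsetP=> X Z XM ZM neXZ.
  have XF : X \in F by move: (Mtight _ XM); rewrite inE => /andP[].
  have ZF : Z \in F by move: (Mtight _ ZM); rewrite inE => /andP[].
  case/or3P: (lam _ _ XF ZF) => // sub.
    by rewrite (Mmax _ _ XM (Mtight _ ZM) sub) eqxx in neXZ.
  by rewrite (Mmax _ _ ZM (Mtight _ XM) sub) eqxx in neXZ.
have covB : cover M \subset B.
  by apply/bigcupsP=> X /Mtight; rewrite inE => /andP[/FB].
have Ycov : Y \subset cover M.
  apply/subsetP=> y yY.
  (* Removing y from the minimal Y violates the requirement of some X, which therefore contains y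
     and was tight. *)
  have : ~~ ok (Y :\ y).
    apply/negP=> /minY; rewrite leqNgt; apply/negP/negPn.
    by rewrite [ltnRHS](cardsD1 y) yY.
  rewrite negb_and (subset_trans (subD1set _ _) YB) /= negb_forall_in.
  case/exists_inP=> X XF; rewrite -ltnNge => lt.
  have := okY _ XF => okX.
  have yX : y \in X.
    apply: contraLR lt => ynX; rewrite -leqNgt.
    suff -> : X :&: (Y :\ y) = X :&: Y by [].
    apply/setP=> x; rewrite !inE; case: eqP => // ->.
    by rewrite (negbTE ynX).
  have eqc : #|X :&: Y| = (#|X :&: (Y :\ y)|).+1.
    by rewrite (cardsD1 y) inE yX yY setIDA.
  have Xt : X \in tight.
    by rewrite inE XF; apply/andP; split; [lia | apply/eqP; lia].
  have [Z ZX XZ] : exists2 Z, Z \in M & X \subset Z.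
    pose P Z := (Z \in tight) && (X \subset Z).
    have PX : P X by rewrite /P Xt subxx.
    case: (arg_maxnP (fun Z : {set T} => #|Z|) PX) => Z /andP[Zt XZ] maxZ.
    exists Z => //; rewrite inE Zt; apply/forall_inP=> W Wt; apply/implyP=> ZW.
    by rewrite eqEcard ZW; apply: maxZ; rewrite /P Wt (subset_trans XZ).
  by apply/bigcupP; exists Z => //; apply: (subsetP XZ).
have cardY : #|Y| <= \sum_(X in M) #|X :&: Y|.
  have -> : \sum_(X in M) #|X :&: Y| = \sum_(y in Y) \sum_(X in M) (y \in X).
    rewrite exchange_big; apply: eq_bigr => X _; rewrite setIC -sum1_card.
    rewrite (eq_bigl (fun y => (y \in Y) && (y \in X))) => [|y]; last by rewrite inE.
    by rewrite big_mkcondr /=; apply: eq_bigr => y _; case: (y \in X).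
  rewrite -sum1_card; apply: leq_sum => y /(subsetP Ycov) /bigcupP[X XM yX].
  by rewrite (bigD1 X) //= yX.
have cardM : \sum_(X in M) #|X| <= #|B|.
  by rewrite (eqP trivM) subset_leq_card.
have tightE X : X \in M -> #|X :&: Y| + h = minn q #|X| /\ h < #|X|.
  by move/Mtight; rewrite inE => /andP[_ /andP[lt /eqP <-]]; split => //; lia.
have sumE : #|Y| + #|M| * h <= \sum_(X in M) minn q #|X|.
  apply: leq_trans (leq_add cardY (leqnn _)) _.
  by rewrite -sum_nat_const -big_split /=; apply: leq_sum => X /tightE[->].
exists Y, #|M|; split=> //.
- by apply: leq_trans sumE _; rewrite -sum_nat_const leq_sum // => X _; apply: geq_minl.
- by apply: leq_trans sumE (leq_trans _ cardM); apply: leq_sum => X _; apply: geq_minr.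
- by apply: leq_trans cardM; rewrite -sum_nat_const; apply: leq_sum => X /tightE[].
Qed.

(** * Nested neighbourhoods in a tame pair *)

Section Tame.
Variables (T : finType) (e : rel T).
Hypotheses (e_sym : symmetric e) (e_irr : irreflexive e).
Variables A B : {set T}.
Hypothesis tameAB : tame e A B.

Definition closed_nbr (X : {set T}) v := [set u in X | (u == v) || e v u].
Definition nbr (X : {set T}) v := [set u in X | e v u].

Local Notation up := (closed_nbr A).
Local Notation nb := (nbr B).

Lemma closed_nbr_self (X : {set T}) v : v \in X -> v \in closed_nbr X v.
Proof. by move=> vX; rewrite inE vX eqxx. Qed.

(** Points refuting both inclusions would induce, with u and v, a P4 or C4, against [tame_nest].
    Thus A is trivially perfect: the comparability graph of a rooted forest. *)
Lemma tame_up_total u v : u \in A -> v \in A -> e u v ->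
  (up u \subset up v) || (up v \subset up u).
Proof.
move=> uA vA uv; apply: contraT; rewrite negb_or.
case/andP=> /subsetPn[w + wv] /subsetPn[w' + w'u].
rewrite !inE => /andP[wA hw] /andP[w'A hw'].
move: wv w'u; rewrite !inE wA w'A /= !negb_or => /andP[wv vw] /andP[w'u uw'].
have uw : e u w by case/orP: hw vw => // /eqP ->; rewrite e_sym uv.
have vw' : e v w' by case/orP: hw' uw' => // /eqP ->; rewrite uv.
by have := tame_nest tameAB uA vA wA w'A uv uw vw' wv w'u; rewrite (negbTE vw) (negbTE uw').
Qed.

(** Take [up r] of least size below [up v]. Every neighbour x of r in A then has [up r] inside
    [up x], so these neighbours are pairwise adjacent: r is a leaf of the forest. *)
Lemma tame_leaf v : v \in A ->
  exists r, [/\ r \in A, up r \subset up v & clique e (up r)].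
Proof.
move=> vA; pose P r := (r \in A) && (up r \subset up v).
have Pv : P v by rewrite /P vA subxx.
case: (arg_minnP (fun r => #|up r|) Pv) => r /andP[rA rv] minr.
exists r; split=> // x y xr yr nxy.
have [xA hx] : x \in A /\ (x == r) || e r x by move: xr; rewrite inE => /andP.
suff /subsetP/(_ _ yr) : up r \subset up x by rewrite inE eq_sym (negbTE nxy) => /andP[].
case/orP: hx => [/eqP -> // | rx].
case/orP: (tame_up_total rA xA rx) => // xr'.
have /eqP-> // : up r == up x.
by rewrite eq_sym eqEcard xr' minr // /P xA (subset_trans xr').
Qed.

(** A point w of [up v] outside [up u] makes u, v, w an induced P3 with middle v. *)
Lemma tame_strict u v : u \in A -> v \in A -> e u v ->
  ~~ (up v \subset up u) -> nb u \subset nb v.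
Proof.
move=> uA vA uv /subsetPn[w]; rewrite !inE => /andP[wA hw].
rewrite wA negb_or /= => /andP[wu uw].
have vw : e v w by case/orP: hw uw => // /eqP ->; rewrite uv.
apply/subsetP=> b; rewrite !inE => /andP[bB ub]; rewrite bB.
by apply: (tame_P3 tameAB uA vA wA bB uv vw _ uw ub); rewrite eq_sym.
Qed.

Hypothesis B_clique : clique e B.

Lemma tame_nb_total u v : u \in A -> v \in A -> e u v ->
  (nb u \subset nb v) || (nb v \subset nb u).
Proof.
move=> uA vA uv; apply: contraT; rewrite negb_or.
case/andP=> /subsetPn[b + bv] /subsetPn[b' + b'u].
rewrite !inE => /andP[bB ub] /andP[b'B vb'].
move: bv b'u; rewrite !inE bB b'B /= => vb ub'.
have bb' : e b b' by apply: B_clique => //; apply: contraNneq vb => ->.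
by have := tame_C4 tameAB uA vA bB b'B uv bb' ub vb'; rewrite (negbTE vb) (negbTE ub').
Qed.

(** By [tame_strict] and [tame_nb_total] the two inclusion orders never conflict on adjacent
    vertices, so the sum of sizes is a single key that decides both. *)
Lemma tame_order u v : u \in A -> v \in A -> e u v ->
  #|up v| + #|nb v| <= #|up u| + #|nb u| -> (up v \subset up u) && (nb v \subset nb u).
Proof.
move=> uA vA uv le.
have vu : e v u by rewrite e_sym.
have upvu : up v \subset up u.
  apply: contraT => nsub; have nbuv := tame_strict uA vA uv nsub.
  have upuv : up u \proper up v.
    by rewrite properE nsub andbT; move: (tame_up_total uA vA uv); rewrite (negbTE nsub) orbF.
  have := proper_card upuv; have := subset_leq_card nbuv; lia.
rewrite upvu /=.
have [upuv | nsub] := boolP (up u \subset up v); last exact: tame_strict vA uA vu nsub.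
case/orP: (tame_nb_total uA vA uv) => // nbuv.
have /eqP-> // : nb v == nb u.
rewrite eq_sym eqEcard nbuv; have := subset_leq_card upuv; lia.
Qed.

Lemma tame_laminar u v : u \in A -> v \in A ->
  [|| nb u \subset nb v, nb v \subset nb u | [disjoint nb u & nb v]].
Proof.
move=> uA vA; have [-> | neq] := eqVneq u v; first by rewrite subxx.
have [uv | nuv] := boolP (e u v); first by rewrite orbA tame_nb_total.
suff -> : [disjoint nb u & nb v] by rewrite !orbT.
rewrite -setI_eq0; apply/eqP/setP=> b; rewrite !inE.
apply/negP=> /andP[/andP[bB ub] /andP[_ vb]].
by have := tame_disj tameAB uA vA bB neq nuv ub; rewrite vb.
Qed.

End Tame.

(** * Greedy extension of a colouring *)

Section Greedy.
Variables (T : finType) (e : rel T).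
Hypotheses (e_sym : symmetric e) (e_irr : irreflexive e).

Definition proper_on (k : nat) (S : {set T}) (c : T -> nat) : Prop :=
  (forall x, x \in S -> c x < k) /\
  (forall x y, x \in S -> y \in S -> e x y -> c x != c y).

Lemma free_color (k : nat) (s : seq nat) : size s < k -> exists2 i, i < k & i \notin s.
Proof.
move=> lt; have [/allP all_in | /allPn[i]] := boolP (all (mem s) (iota 0 k)).
  by have := uniq_leq_size (iota_uniq 0 k) all_in; rewrite size_iota leqNgt lt.
by rewrite mem_iota add0n => ik i_s; exists i.
Qed.

(** The bound is on a list of colours rather than on the degree, so neighbours that share a colour
    can be charged once. *)
Lemma proper_on_extend k (S : {set T}) c v (s : seq nat) :
  proper_on k (S :\ v) c -> size s < k ->
  (forall u, u \in S :\ v -> e v u -> c u \in s) ->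
  exists2 c', proper_on k S c' & forall x, x != v -> c' x = c x.
Proof.
move=> [ck cP] /free_color[i ik i_s] nbr_s.
exists (fun x => if x == v then i else c x) => [|x /negbTE -> //].
split=> [x xS | x y xS yS xy].
  by case: eqVneq => // xv; apply: ck; rewrite !inE xv.
case: (eqVneq x v) => [xv | xv]; case: (eqVneq y v) => [yv | yv].
- by rewrite xv yv e_irr in xy.
- by apply: contraNneq i_s => ->; apply: nbr_s; rewrite ?inE ?yv // -xv.
- by apply: contraNneq i_s => <-; apply: nbr_s; rewrite ?inE ?xv // -yv e_sym.
- by apply: cP => //; rewrite !inE ?xv ?yv.
Qed.

End Greedy.

(** * Colouring when B is a clique *)

Section Colouring.
Variables (T : finType) (e : rel T).
Hypotheses (e_sym : symmetric e) (e_irr : irreflexive e).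

Lemma clique_setU (X Y : {set T}) :
  clique e X -> clique e Y -> complete e X Y -> clique e (X :|: Y).
Proof.
move=> cX cY XY x y /setUP[xX | xY] /setUP[yX | yY] ne; auto.
by rewrite e_sym XY.
Qed.

Lemma card_complete_setU (X Y : {set T}) :
  complete e X Y -> #|X :|: Y| = #|X| + #|Y|.
Proof.
move=> XY; rewrite cardsU (_ : X :&: Y = set0) ?cards0 ?subn0 //.
apply/setP=> x; rewrite !inE; apply/negP=> /andP[xX xY].
by have := XY _ _ xX xY; rewrite e_irr.
Qed.

Lemma index_lt (X : {set T}) x : x \in X -> index x (enum X) < #|X|.
Proof. by move=> xX; rewrite cardE index_mem mem_enum. Qed.

Lemma index_neq (s : seq T) x y : x \in s -> x != y -> index x s != index y s.
Proof.
move=> xs; apply: contra_neq => eq_i; have : y \in s by rewrite -index_mem -eq_i index_mem.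
by move=> ys; rewrite -(nth_index x xs) eq_i nth_index.
Qed.

(* Colours: Y gets [0, t), the rest of B gets [t, b), Q4 gets [b, b + #|Q4|), Q1
   reuses the colours of Y and then those of Q4, and Q5 reuses those of B outside Y. *)
Lemma base_colouring (Q1 A B Q4 Q5 Y : {set T}) (k : nat) :
  ring5 e Q1 A B Q4 Q5 -> clique e B -> Y \subset B -> #|Y| <= #|Q1| ->
  #|B| + maxn #|Q4| (#|Q1| - #|Y|) <= k ->
  #|Y| + maxn #|Q4| (#|Q1| - #|Y|) + #|Q5| <= k ->
  exists c, [/\ proper_on e k (Q1 :|: B :|: Q4 :|: Q5) c &
    forall y, y \in Y -> exists2 x, x \in Q1 & c x = c y].
Proof.
move=> ring clB YB tq1 hk1 hk2.
set b := #|B| in hk1 *; set t := #|Y| in tq1 hk1 hk2 *.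
set M := maxn _ _ in hk1 hk2.
have tb : t <= b by apply: subset_leq_card.
have [M4 M1] : #|Q4| <= M /\ #|Q1| - t <= M by rewrite /M; lia.
pose s := enum Y ++ enum (B :\: Y).
pose i1 x := index x (enum Q1); pose i4 x := index x (enum Q4).
pose i5 x := index x (enum Q5); pose iB x := index x s.
have mem_s x : x \in B -> x \in s.
  by move=> xB; rewrite mem_cat !mem_enum inE xB andbT orbN.
have size_s : size s = b.
  by rewrite size_cat -!cardE cardsD (setIidPr YB) subnKC.
have iBlt x : x \in B -> iB x < b by move=> xB; rewrite -size_s index_mem mem_s.
have iBY x : x \in Y -> iB x < t.
  by move=> xY; rewrite /iB index_cat mem_enum xY index_lt.
(* The colours in [[b, b + M)] are kept for Q1 and Q4. Once [i5 x] reaches [b - t], the value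
   [M + t + i5 x] is [b + M + (i5 x - (b - t))], hence fresh. *)
pose c x := if x \in Q1 then (if i1 x < t then i1 x else b + (i1 x - t))
  else if x \in B then iB x else if x \in Q4 then b + i4 x
  else if i5 x < b - t then t + i5 x else M + t + i5 x.
have c1 x : x \in Q1 -> c x = if i1 x < t then i1 x else b + (i1 x - t).
  by rewrite /c => ->.
have cB x : x \in B -> c x = iB x.
  move=> xB; rewrite /c xB; case: ifP => // x1.
  by have /andP[] := ring5_1B ring x1 xB; rewrite eqxx.
have c4 x : x \in Q4 -> c x = b + i4 x.
  move=> x4; rewrite /c x4; case: ifP => x1.
    by have /andP[] := ring5_14 ring x1 x4; rewrite eqxx.
  by case: ifP => // xB; have := ring5_4B ring x4 xB; rewrite e_irr.
have c5 x : x \in Q5 -> c x = if i5 x < b - t then t + i5 x else M + t + i5 x.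
  move=> x5; rewrite /c; case: ifP => x1.
    by have := ring5_15 ring x1 x5; rewrite e_irr.
  case: ifP => xB; first by have /andP[] := ring5_5B ring x5 xB; rewrite eqxx.
  by case: ifP => // x4; have := ring5_45 ring x4 x5; rewrite e_irr.
have ne15 x y : x \in Q1 -> y \in Q5 -> c x != c y.
  move=> x1 y5; rewrite c1 // c5 //; have := index_lt x1; rewrite -/(i1 x) => ?.
  by do 2 case: ifP; lia.
have ne45 x y : x \in Q4 -> y \in Q5 -> c x != c y.
  move=> x4 y5; rewrite c4 // c5 //; have := index_lt x4; rewrite -/(i4 x) => ?.
  by case: ifP; lia.
have neB4 x y : x \in B -> y \in Q4 -> c x != c y.
  by move=> xB y4; rewrite cB // c4 //; have := iBlt _ xB; lia.
have ne11 x y : x \in Q1 -> y \in Q1 -> x != y -> c x != c y.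
  move=> x1 y1 ne; rewrite !c1 //.
  have : i1 x != i1 y by apply: index_neq; rewrite ?mem_enum.
  by do 2 case: ifP; lia.
have ne55 x y : x \in Q5 -> y \in Q5 -> x != y -> c x != c y.
  move=> x1 y1 ne; rewrite !c5 //.
  have : i5 x != i5 y by apply: index_neq; rewrite ?mem_enum.
  by do 2 case: ifP; lia.
exists c; split; first split.
- move=> x; rewrite !in_setU -!orbA => /or4P[x1 | xB | x4 | x5].
  + by rewrite c1 //; have := index_lt x1; rewrite -/(i1 x); case: ifP; lia.
  + by rewrite cB //; have := iBlt _ xB; lia.
  + by rewrite c4 //; have := index_lt x4; rewrite -/(i4 x); lia.
  + by rewrite c5 //; have := index_lt x5; rewrite -/(i5 x); case: ifP; lia.
- move=> x y; rewrite !in_setU -!orbA => xS yS xy.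
  have ne := neq_of_edge e_irr xy; have yx : e y x by rewrite e_sym.
  case/or4P: xS => [x1 | xB | x4 | x5]; case/or4P: yS => [y1 | yB | y4 | y5].
  + exact: ne11.
  + by have /andP[_] := ring5_1B ring x1 yB; rewrite xy.
  + by have /andP[_] := ring5_14 ring x1 y4; rewrite xy.
  + exact: ne15.
  + by have /andP[_] := ring5_1B ring y1 xB; rewrite yx.
  + by rewrite !cB // index_neq // mem_s.
  + exact: neB4.
  + by have /andP[_] := ring5_5B ring y5 xB; rewrite yx.
  + by have /andP[_] := ring5_14 ring y1 x4; rewrite yx.
  + by rewrite eq_sym neB4.
  + by rewrite !c4 // eqn_add2l index_neq // mem_enum.
  + exact: ne45.
  + by rewrite eq_sym ne15.
  + by have /andP[_] := ring5_5B ring x5 yB; rewrite xy.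
  + by rewrite eq_sym ne45.
  + exact: ne55.
- move=> y yY; have yB := subsetP YB _ yY; have lt := iBY _ yY.
  have szQ : iB y < size (enum Q1) by rewrite -cardE; apply: leq_trans tq1.
  have n1 : nth y (enum Q1) (iB y) \in Q1 by rewrite -mem_enum mem_nth.
  exists (nth y (enum Q1) (iB y)) => //.
  by rewrite c1 // cB // /i1 index_uniq ?enum_uniq // lt.
Qed.

Lemma ring5_clique_colouring (Q1 A B Q4 Q5 : {set T}) (W h : nat) :
  ring5 e Q1 A B Q4 Q5 -> tame e A B -> clique e B ->
  (forall K : {set T}, clique e K -> #|K| <= W) -> W <= 4 * h ->
  exists c, proper_on e (W + h) (Q1 :|: B :|: Q4 :|: Q5 :|: A) c.
Proof.
move=> ring tm clB hW hh.
have le15 : #|Q1| + #|Q5| <= W.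
  rewrite -card_complete_setU ?hW //; last exact: ring5_15 ring.
  by apply: clique_setU (ring5_15 ring); [exact: ring5_cl1 ring | exact: ring5_cl5 ring].
have le45 : #|Q4| + #|Q5| <= W.
  rewrite -card_complete_setU ?hW //; last exact: ring5_45 ring.
  by apply: clique_setU (ring5_45 ring); [exact: ring5_cl4 ring | exact: ring5_cl5 ring].
have le4B : #|Q4| + #|B| <= W.
  rewrite -card_complete_setU ?hW //; last exact: ring5_4B ring.
  by apply: clique_setU (ring5_4B ring); first exact: ring5_cl4 ring.
pose nb := nbr e B; pose up := closed_nbr e A.
have nbB v : nb v \subset B by apply/subsetP=> x; rewrite inE => /andP[].
(* With truncated subtraction the second term is the minimum of [#|Q1|] and [W + h - #|Q4| - #|Q5|],
   the most that leaves room for Q4 and Q5. Y is taken this large so that B and the rest of Q1 fit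
   as well. *)
have [Y [YB Ycard hY]] : exists Y : {set T},
    [/\ Y \subset B,
        #|Y| = minn #|B| (#|Q1| - (#|Q1| + #|Q4| + #|Q5| - (W + h))) &
        forall v, v \in A -> minn #|Q1| #|nb v| <= #|nb v :&: Y| + h].
  have [|| Y0 [p [Y0B hit h1 h2 h3]]] :=
    @laminar_hitting T [set nb v | v in A] B #|Q1| h.
  - by move=> X /imsetP[v _ ->].
  - by move=> X Z /imsetP[u uA ->] /imsetP[v vA ->]; apply: (tame_laminar tm clB).
  (* Four members would need [4 * h.+1] points, but [#|B| <= W <= 4 * h]. *)
  have p3 : p <= 3.
    by rewrite leqNgt; apply/negP=> p4; have := leq_mul p4 (leqnn h.+1); lia.
  have le0 : #|Y0| <= minn #|B| (#|Q1| - (#|Q1| + #|Q4| + #|Q5| - (W + h))).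
    by case: p h1 h2 h3 p3 => [|[|[|[|p]]]] //; lia.
  have [|Y Y0Y /andP[YB /eqP cY]] :=
    @subset_of_card T Y0 B (minn #|B| (#|Q1| - (#|Q1| + #|Q4| + #|Q5| - (W + h)))) Y0B.
    by rewrite le0 geq_minl.
  exists Y; split=> // v vA; apply: leq_trans (hit _ (imset_f _ vA)) _.
  by rewrite leq_add2r subset_leq_card // setIS.
have [|||c0 [c0P c0Y]] := @base_colouring Q1 A B Q4 Q5 Y (W + h) ring clB YB; try lia.
set S0 := Q1 :|: B :|: Q4 :|: Q5 in c0P *.
have AS0 x : x \in A -> x \notin S0.
  move=> xA; rewrite !inE !negb_or -!andbA (ring5_AB ring xA) /=.
  apply/and3P; split; apply/negP=> xQ.
  - by have := ring5_1A ring xQ xA; rewrite e_irr.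
  - by have /andP[] := ring5_4A ring xQ xA; rewrite eqxx.
  - by have /andP[] := ring5_5A ring xQ xA; rewrite eqxx.
(* Agreement with [c0] outside A' is carried along so that the colours of Y still occur on Q1. *)
suff main n : forall A' : {set T}, #|A'| = n -> A' \subset A ->
    exists2 c, proper_on e (W + h) (S0 :|: A') c & forall x, x \notin A' -> c x = c0 x.
  by have [c cP _] := main _ A erefl (subxx _); exists c.
elim: n => [|n IHn] A' cardA' A'A.
  by move/eqP: cardA'; rewrite cards_eq0 => /eqP->; exists c0; rewrite ?setU0.
have [v0 v0A'] : exists x, x \in A' by apply/card_gt0P; rewrite cardA'.
pose f v := #|up v| + #|nb v|.
(* The vertex with the smallest key is coloured last; by [tame_order] the neighbourhoods of its
   neighbours in A' contain its own. *)
case: (arg_minnP (P := [in A']) f v0A') => v vA' minv.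
have vA := subsetP A'A _ vA'.
have [||c cP cE] := IHn (A' :\ v).
- by have := cardsD1 v A'; rewrite vA' cardA'; lia.
- by rewrite (subset_trans _ A'A) ?subD1set.
have SDv : (S0 :|: A') :\ v = S0 :|: A' :\ v.
  by rewrite setDUl (setDidPl _) // disjoint_sym disjoints1 AS0.
pose anc := [set u in A' :\ v | e v u].
have ancP u : u \in anc -> [/\ u \in A', u \in A, u != v, e v u &
    (up v \subset up u) && (nb v \subset nb u)].
  rewrite !inE => /andP[/andP[uv uA'] vu]; have uA := subsetP A'A _ uA'.
  by split=> //; apply: (tame_order e_sym tm clB) => //; [rewrite e_sym | apply: minv].
have cl_v : clique e (v |: anc).
  move=> x y /setU1P[-> | xa] /setU1P[-> | ya] ne.
  - by rewrite eqxx in ne.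
  - by case: (ancP _ ya).
  - by rewrite e_sym; case: (ancP _ xa).
  - have [_ xA _ _ /andP[/subsetP upx _]] := ancP _ xa.
    have [_ yA _ vy _] := ancP _ ya.
    have := upx y; rewrite !inE yA vy orbT => /(_ isT).
    by rewrite eq_sym (negbTE ne).
have card_v : #|v |: anc| = #|anc|.+1 by rewrite cardsU1 !inE eqxx.
have le1 : #|Q1| + #|anc|.+1 <= W.
  have cpl : complete e Q1 (v |: anc).
    move=> x y x1 /setU1P[-> | /ancP[_ yA _ _ _]]; exact: ring5_1A ring _ _ x1 _.
  rewrite -card_v -card_complete_setU ?hW //.
  by apply: clique_setU cpl; first exact: ring5_cl1 ring.
have le2 : #|anc|.+1 + #|nb v| <= W.
  have cpl : complete e (v |: anc) (nb v).
    move=> x y /setU1P[-> | /ancP[_ _ _ _ /andP[_ /subsetP sub]]].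
      by rewrite inE => /andP[].
    by move/sub; rewrite inE => /andP[].
  rewrite -card_v -card_complete_setU ?hW //.
  apply: clique_setU cpl => // x y xn yn; apply: clB; exact: subsetP (nbB v) _ _.
have nbY : #|nb v :\: Y| = #|nb v| - #|nb v :&: Y| by rewrite cardsD.
have := hY _ vA => hYv.
have nbYle : #|nb v :&: Y| <= #|nb v| by rewrite subset_leq_card ?subsetIl.
(* Colours of Y already occur on Q1. By [hYv] the length is at most [#|anc| + #|nb v| + h] or
   [#|Q1| + #|anc| + h], and [le2] or [le1] makes it less than [W + h]. *)
pose s := map c (enum Q1) ++ map c (enum anc) ++ map c (enum (nb v :\: Y)).
rewrite -SDv in cP.
have [||c' c'P c'E] := @proper_on_extend T e e_sym e_irr (W + h) (S0 :|: A') c v s cP.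
- by rewrite !size_cat !size_map -!cardE nbY; lia.
- move=> u; rewrite SDv => uS vu; rewrite !mem_cat.
  have out x : x \in S0 -> x \notin A' :\ v.
    by move=> xS; apply: contraL xS => /setD1P[_ /(subsetP A'A)/AS0].
  case/setUP: uS => [|uA']; last first.
    by rewrite orbA [_ \in map c (enum anc)]map_f ?orbT // mem_enum inE uA'.
  move=> uS; case/setUP: (uS) => [/setUP[/setUP[u1 | uB] | u4] | u5].
  + by rewrite map_f // mem_enum.
  + have [uY | nuY] := boolP (u \in Y).
      have [x x1 cx] := c0Y _ uY.
      have -> : c u = c x by rewrite !cE ?out // !inE x1.
      by rewrite map_f // mem_enum.
    by rewrite [_ \in map c (enum (_ :\: _))]map_f ?orbT // mem_enum !inE nuY uB.
  + by have /andP[_] := ring5_4A ring u4 vA; rewrite e_sym vu.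
  + by have /andP[_] := ring5_5A ring u5 vA; rewrite e_sym vu.
exists c' => // x xA'; rewrite c'E.
  by apply: cE; rewrite !inE (negbTE xA') andbF.
by apply: contraNneq xA' => ->.
Qed.

End Colouring.

(** * From cliques and degrees to the chromatic number of a belt *)

Section Belt.
Variables (T : finType) (e : rel T).
Hypotheses (e_sym : symmetric e) (e_irr : irreflexive e).

Lemma cliqueP (K : {set T}) : reflect (clique e K) (cliqueb e K).
Proof.
apply: (iffP forallP) => [h x y xK yK xy | h x].
  by have /forallP/(_ y)/implyP := h x; apply; rewrite xK yK xy.
by apply/forallP=> y; apply/implyP=> /and3P[*]; apply: h.
Qed.

Lemma nonclique_pair (K : {set T}) : ~~ cliqueb e K ->
  exists x y, [/\ x \in K, y \in K, x != y & ~~ e x y].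
Proof.
case/forallPn=> x /forallPn[y]; rewrite negb_imply => /andP[/and3P[? ? ?] ?].
by exists x, y.
Qed.

Lemma clique_le_omega (K : {set T}) : clique e K -> #|K| <= omega e.
Proof. by move=> /cliqueP clK; apply: leq_bigmax_cond. Qed.

Lemma chi_le_colouring k c : proper_on e k [set: T] c -> chi e <= k.
Proof.
move=> [ck cP].
(* A k above [#|T|] is outside the index range, but the minimum never exceeds its default value
   [#|T|]. *)
have [lt | le] := ltnP k #|T|.+1; last first.
  apply: leq_trans (ltnW le); rewrite /chi; elim/big_ind: _ => // [x y xT yT | i _].
    by rewrite geq_min xT.
  by rewrite -ltnS ltn_ord.
have col : colorable e k.
  apply/existsP; exists [ffun x => Ordinal (ck x (in_setT x))].
  apply/forallP=> x; apply/forallP=> y; apply/implyP=> xy.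
  by rewrite !ffunE -val_eqE /=; apply: cP.
rewrite /chi; have := mem_index_enum (Ordinal lt).
elim: index_enum => // i r IHr; rewrite inE big_cons => /orP[/eqP <- | /IHr le].
  by rewrite col geq_minl.
by case: ifP => // _; rewrite geq_min le orbT.
Qed.

(** A leaf r, its neighbours in A and Q1 form a clique of size at most W. So r has fewer than W
    neighbours outside B, and the degree bound leaves more than h in B. *)
Lemma two_leaves (Q1 A B Q4 Q5 : {set T}) (W h : nat) :
  ring5 e Q1 A B Q4 Q5 -> tame e A B ->
  (forall K : {set T}, clique e K -> #|K| <= W) ->
  (forall v, v \in A ->
     W + h <= #|[set y in Q1 :|: A :|: B :|: Q4 :|: Q5 | e v y]|) ->
  ~~ cliqueb e A ->
  exists r1 r2, [/\ r1 \in A, r2 \in A, r1 != r2, ~~ e r1 r2 &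
    h < #|nbr e B r1| /\ h < #|nbr e B r2|].
Proof.
move=> ring tm hW hdeg /nonclique_pair[a1 [a2 [a1A a2A ne nadj]]].
have leaf_deg r : r \in A -> clique e (closed_nbr e A r) -> h < #|nbr e B r|.
  move=> rA clr; have cpl : complete e Q1 (closed_nbr e A r).
    by move=> x y x1; rewrite inE => /andP[yA _]; apply: (ring5_1A ring).
  have cl1 : #|Q1| + #|closed_nbr e A r| <= W.
    rewrite -(card_complete_setU e_irr cpl) hW //.
    by apply: clique_setU cpl => //; exact: ring5_cl1 ring.
  have rr := closed_nbr_self e rA.
  have sub : [set y in Q1 :|: A :|: B :|: Q4 :|: Q5 | e r y] \subset
      (Q1 :|: (closed_nbr e A r) :\ r) :|: nbr e B r.
    apply/subsetP=> y; rewrite inE => /andP[yS ry].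
    have nyr : y != r by rewrite eq_sym (neq_of_edge e_irr ry).
    move: yS; rewrite !inE ry nyr orbT !andbT => /orP[/orP[-> // | y4] | y5].
      by have /andP[_] := ring5_4A ring y4 rA; rewrite e_sym ry.
    by have /andP[_] := ring5_5A ring y5 rA; rewrite e_sym ry.
  have := subset_leq_card sub; have := hdeg _ rA.
  have [+ _] := leq_card_setU (Q1 :|: closed_nbr e A r :\ r) (nbr e B r).
  have [+ _] := leq_card_setU Q1 (closed_nbr e A r :\ r).
  by have := cardsD1 r (closed_nbr e A r); rewrite rr /=; lia.
have [r1 [r1A /subsetP r1a1 cl1]] := tame_leaf e_sym tm a1A.
have [r2 [r2A /subsetP r2a2 cl2]] := tame_leaf e_sym tm a2A.
(* Otherwise r1 lies in the closed neighbourhood of a2, so a2 lies in that of r1 and hence in that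
   of a1. *)
have far : r1 \notin closed_nbr e A r2.
  apply/negP=> /r2a2; rewrite inE r1A /= => r1a2.
  have : a2 \in closed_nbr e A r1 by rewrite inE a2A eq_sym e_sym.
  by move/r1a1; rewrite inE a2A eq_sym (negbTE ne) (negbTE nadj).
move: far; rewrite inE r1A negb_or e_sym => /andP[ne12 nadj12].
by exists r1, r2; split => //; split; apply: leaf_deg.
Qed.

(** The conditions on R2 and R3 concern the whole sets and are fixed before S, since the vertices
    from which they are derived may be missing in S. *)
Lemma belt_colouring (Q1 Q2 Q3 Q4 Q5 R2 R3 : {set T}) (W h : nat) :
  ring5 e Q1 (Q2 :|: R2) (Q3 :|: R3) Q4 Q5 ->
  tame e (Q2 :|: R2) (Q3 :|: R3) -> tame e (Q3 :|: R3) (Q2 :|: R2) ->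
  clique e Q2 -> clique e Q3 -> complete e Q2 R2 -> complete e Q3 R3 ->
  (forall c b, c \in R2 -> b \in Q3 :|: R3 -> e c b ->
     b \in Q3 /\ forall q, q \in Q2 -> e q b) ->
  (forall c b, c \in R3 -> b \in Q2 :|: R2 -> e c b ->
     b \in Q2 /\ forall q, q \in Q3 -> e q b) ->
  (forall K : {set T}, clique e K -> #|K| <= W) -> W <= 4 * h ->
  forall S : {set T},
    S \subset Q1 :|: (Q2 :|: R2) :|: (Q3 :|: R3) :|: Q4 :|: Q5 ->
  exists c, proper_on e (W + h) S c.
Proof.
set A := Q2 :|: R2; set B := Q3 :|: R3.
move=> ring tAB tBA cl2 cl3 cp2 cp3 hR2 hR3 hW hh S.
elim: {S}#|S| {-2}S (erefl #|S|) => [|n IHn] S cardS Ssub.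
  move/eqP: cardS; rewrite cards_eq0 => /eqP->.
  by exists (fun=> 0); split=> x; rewrite ?inE // => y; rewrite inE.
have [/exists_inP[v vS small] | /exists_inPn big] :=
    boolP [exists v in S, #|[set y in S | e v y]| < W + h].
  have [||c cP] := IHn (S :\ v).
  - by have := cardsD1 v S; rewrite vS cardS; lia.
  - by rewrite (subset_trans _ Ssub) ?subD1set.
  have [||c' c'P _] := @proper_on_extend T e e_sym e_irr (W + h) S c v
      (map c (enum [set y in S | e v y])) cP; last by exists c'.
    by rewrite size_map -cardE.
  by move=> u /setD1P[_ uS] vu; rewrite map_f // mem_enum inE uS.
have ringS := ring5_setI S ring.
have tABS := tame_setI S tAB; have tBAS := tame_setI S tBA.
have SE : S = Q1 :&: S :|: A :&: S :|: B :&: S :|: Q4 :&: S :|: Q5 :&: S.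
  by rewrite -!setIUl; apply/esym/setIidPr.
have [/cliqueP clB | nclB] := boolP (cliqueb e (B :&: S)).
  have [c] := ring5_clique_colouring e_sym e_irr ringS tABS clB hW hh.
  by rewrite -!setIUl (setIidPr _) => [cP|]; [exists c |
     apply: subset_trans Ssub _; apply/subsetP=> x; rewrite !in_setU; do !case: (_ \in _)].
have [/cliqueP clA | nclA] := boolP (cliqueb e (A :&: S)).
  have [c] := ring5_clique_colouring e_sym e_irr (ring5_sym e_sym ringS) tBAS clA hW hh.
  by rewrite -!setIUl (setIidPr _) => [cP|]; [exists c |
     apply: subset_trans Ssub _; apply/subsetP=> x; rewrite !in_setU; do !case: (_ \in _)].
exfalso.
have degA v : v \in A :&: S -> W + h <= #|[set y in Q1 :&: S :|: A :&: S :|: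
    B :&: S :|: Q4 :&: S :|: Q5 :&: S | e v y]|.
  by rewrite -SE => /setIP[_ vS]; rewrite leqNgt; apply: big.
have degB v : v \in B :&: S -> W + h <= #|[set y in Q4 :&: S :|: B :&: S :|:
    A :&: S :|: Q1 :&: S :|: Q5 :&: S | e v y]|.
  rewrite (_ : _ :|: Q5 :&: S = S) => [/setIP[_ vS]|].
    by rewrite leqNgt; apply: big.
  by rewrite [RHS]SE; apply/setP=> x; rewrite !in_setU; do !case: (_ \in _).
have [r1 [r2 [r1A r2A ner nadjr [big1 big2]]]] :=
  two_leaves ringS tABS hW degA nclA.
have [s1 [s2 [s1B s2B nes nadjs [big3 big4]]]] :=
  two_leaves (ring5_sym e_sym ringS) tBAS hW degB nclB.
(* A vertex of Q is adjacent to all the rest of Q and R, so a non-adjacent pair lies in R. *)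
have inR (Q R : {set T}) r r' : clique e Q -> complete e Q R ->
    r \in (Q :|: R) :&: S -> r' \in (Q :|: R) :&: S -> r != r' -> ~~ e r r' -> r \in R.
  move=> clQ cpl /setIP[/setUP[rQ | //] _] /setIP[/setUP[r'Q | r'R] _] ne.
    by rewrite clQ.
  by rewrite cpl.
have nadjr' : ~~ e r2 r1 by rewrite e_sym.
have nadjs' : ~~ e s2 s1 by rewrite e_sym.
have r1R := inR _ _ _ _ cl2 cp2 r1A r2A ner nadjr.
have r2R : r2 \in R2 by apply: (inR _ _ _ _ cl2 cp2 r2A r1A) => //; rewrite eq_sym.
have s1R := inR _ _ _ _ cl3 cp3 s1B s2B nes nadjs.
have s2R : s2 \in R3 by apply: (inR _ _ _ _ cl3 cp3 s2B s1B) => //; rewrite eq_sym.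
(* X lies in Q3, Z in Q2, and they are complete to each other. Each is a disjoint union of two sets
   with more than h points, so the clique on both has more than [4 * h] points. *)
pose X := nbr e (B :&: S) r1 :|: nbr e (B :&: S) r2.
pose Z := nbr e (A :&: S) s1 :|: nbr e (A :&: S) s2.
have XP b : b \in X -> b \in Q3 /\ forall q, q \in Q2 -> e q b.
  case/setUP; rewrite inE => /andP[/setIP[bB _]]; exact: hR2.
have ZP b : b \in Z -> b \in Q2.
  case/setUP; rewrite inE => /andP[/setIP[bB _] rb].
    by have [] := hR3 _ _ s1R bB rb.
  by have [] := hR3 _ _ s2R bB rb.
have ZX : complete e Z X by move=> z x /ZP zQ /XP[_]; apply.
have clZX : #|Z| + #|X| <= W.
  rewrite -(card_complete_setU e_irr ZX) hW //; apply: clique_setU ZX => //.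
    by move=> x y /ZP xQ /ZP yQ; apply: cl2.
  by move=> x y /XP[xQ _] /XP[yQ _]; apply: cl3.
have card_nbrU (C D : {set T}) u v : tame e C D -> u \in C -> v \in C -> u != v ->
    ~~ e u v -> #|nbr e D u :|: nbr e D v| = #|nbr e D u| + #|nbr e D v|.
  move=> tm uC vC ne nadj; rewrite cardsU (_ : _ :&: _ = set0) ?cards0 ?subn0 //.
  apply/setP=> b; rewrite !inE; apply/negP=> /andP[/andP[bD ub] /andP[_ vb]].
  by have := tame_disj tm uC vC bD ne nadj ub; rewrite vb.
have := card_nbrU _ _ _ _ tABS r1A r2A ner nadjr; rewrite -/X.
have := card_nbrU _ _ _ _ tBAS s1B s2B nes nadjs; rewrite -/Z.
clear - big1 big2 big3 big4 clZX hh; lia.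
Qed.

(* Every vertex of Q2 sees all neighbours of R2, so these are pairwise adjacent;
   a neighbour b in R3 of R2 and a non-neighbour b' of b in R3 violate this. *)
Lemma belt_R_nbr (Q2 R2 Q3 R3 : {set T}) :
  tame e (Q2 :|: R2) (Q3 :|: R3) -> tame e (Q3 :|: R3) (Q2 :|: R2) ->
  Q2 != set0 -> complete e Q2 R2 ->
  (forall x, x \in Q3 :|: R3 -> exists2 y, y \in Q2 :|: R2 & e x y) ->
  (forall x, x \in R2 -> exists2 y, y \in R2 & (y != x) && ~~ e x y) ->
  (forall x, x \in R3 -> exists2 y, y \in R3 & (y != x) && ~~ e x y) ->
  forall c b, c \in R2 -> b \in Q3 :|: R3 -> e c b ->
    b \in Q3 /\ forall q, q \in Q2 -> e q b.
Proof.
move=> tAB tBA /set0Pn[q0 q0Q] cp2 nbrB nonR2 nonR3.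
(* With a non-neighbour d of c in R2, the path c, q, d is an induced P3 with middle q. *)
have up c b q : c \in R2 -> b \in Q3 :|: R3 -> e c b -> q \in Q2 -> e q b.
  move=> cR bB cb qQ; have [d dR /andP[dc cd]] := nonR2 _ cR.
  have inA x : x \in R2 -> x \in Q2 :|: R2 by rewrite inE orbC => ->.
  have qA : q \in Q2 :|: R2 by rewrite inE qQ.
  apply: (tame_P3 tAB (inA _ cR) qA (inA _ dR) bB _ _ _ cd cb).
  - by rewrite e_sym cp2.
  - exact: cp2.
  - by rewrite eq_sym.
move=> c b cR bB cb; split; last by move=> q; apply: up bB cb.
case/setUP: (bB) => // bR; exfalso.
have cA : c \in Q2 :|: R2 by rewrite inE cR orbT.
have [b' b'R /andP[ne nadj]] := nonR3 _ bR.
have b'B : b' \in Q3 :|: R3 by rewrite inE b'R orbT.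
have [x xA b'x] := nbrB _ b'B.
have bc : e b c by rewrite e_sym.
have ne' : b != b' by rewrite eq_sym.
have nbx : ~~ e b x.
  by apply: (tame_disj tBA b'B bB xA ne _ b'x); rewrite e_sym.
case/setUP: (xA) => [xQ | xR].
  by have := up _ _ _ cR bB cb xQ; rewrite e_sym (negbTE nbx).
(* Now b and b' both have neighbours in R2, so q0 sees both, although they are not adjacent. *)
have q0A : q0 \in Q2 :|: R2 by rewrite inE q0Q.
have := tame_disj tBA bB b'B q0A ne' nadj.
rewrite ![e _ q0]e_sym (up _ _ _ cR bB cb q0Q) => /(_ isT).
by rewrite (up _ _ _ xR b'B _ q0Q) // e_sym.
Qed.

End Belt.

Theorem theorem5p15 (T : finType) (e : rel T)
  (e_sym : symmetric e) (e_irr : irreflexive e) :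
  belt e -> chi e <= (5 * omega e + 3) %/ 4.
Proof.
case=> P6 [C4 [C6 [Q1 [Q2 [Q3 [Q4 [Q5 [R2 [R3]]]]]]]]].
case=> part [[n1 n2 n3 n4 n5] [[c1 c2 c3 c4 c5] [h1 [h4 [a1 [a4 [a5]]]]]]].
case=> [cp2 [cp3 [nA [nB [non2 non3]]]]].
have ring : ring5 e Q1 (Q2 :|: R2) (Q3 :|: R3) Q4 Q5.
  constructor=> //.
  - by move=> x y xQ yA; apply: h1 => //; rewrite in_setU yA.
  - by move=> x y xQ yA; apply: h4 => //; rewrite in_setU yA.
  - by move=> x y xQ yQ; apply: h1 => //; rewrite in_setU yQ orbT.
  - by move=> x y xQ yQ; apply: h4 => //; rewrite in_setU yQ orbT.
  (* Anticompleteness is given; distinctness comes from the count in [part], here and in the next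
     cases. *)
  - move=> x y xQ yB; apply/andP; split; last first.
      by apply: a1 => //; move: yB; rewrite !in_setU => /orP[] ->; rewrite ?orbT.
    by apply: contraTneq yB => <-; have := part x; rewrite /= xQ !inE; do !case: (x \in _).
  - move=> x y xQ yB; apply/andP; split; last first.
      by apply: a4 => //; move: yB; rewrite !in_setU => /orP[] ->; rewrite ?orbT.
    by apply: contraTneq yB => <-; have := part x; rewrite /= xQ !inE; do !case: (x \in _).
  - move=> x y xQ yB; apply/andP; split; last first.
      by apply: a1 => //; move: yB; rewrite !in_setU => ->; rewrite orbT.
    by apply: contraTneq yB => <-; have := part x; rewrite /= xQ; do !case: (x \in _).
  - move=> x y xQ yB; apply/andP; split; last first.
      by apply: a5 => //; move: yB; rewrite !in_setU => /orP[] ->; rewrite ?orbT.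
    by apply: contraTneq yB => <-; have := part x; rewrite /= xQ !inE; do !case: (x \in _).
  - move=> x y xQ yB; apply/andP; split; last first.
      by apply: a5 => //; move: yB; rewrite !in_setU => /orP[] ->; rewrite ?orbT.
    by apply: contraTneq yB => <-; have := part x; rewrite /= xQ !inE; do !case: (x \in _).
  - by move=> x; rewrite !inE; have := part x; rewrite /=; do !case: (x \in _).
have gnir := ring5_sym e_sym ring.
have tAB := ring_tame e_sym e_irr P6 C4 C6 ring n1 n4 n5 nA.
have tBA := ring_tame e_sym e_irr P6 C4 C6 gnir n4 n1 n5 nB.
have R2nbr := belt_R_nbr e_sym tAB tBA n2 cp2 nB non2 non3.
have R3nbr := belt_R_nbr e_sym tBA tAB n3 cp3 nA non3 non2.
(* Here h is the number of colours minus omega, which is omega / 4 rounded up. *)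
have [||c cP] := belt_colouring e_sym e_irr ring tAB tBA c2 c3 cp2 cp3 R2nbr R3nbr
  (@clique_le_omega T e) (_ : _ <= 4 * ((5 * omega e + 3) %/ 4 - omega e)) (S := setT).
- lia.
- by apply/subsetP=> x _; rewrite !inE; have := part x; rewrite /=; do !case: (x \in _).
by apply: leq_trans (chi_le_colouring cP) _; lia.
Qed.
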